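(* Let $r\ge1$, $\mathbf a=(a_1,\dots,a_{r+1})\in\mathbb{C}^{r+1}$, $\mathbf b_{[1]}=(b_2,\dots,b_r)\in\mathbb{C}^{r-1}$, and suppose no displayed denominator (lower) parameter is a non-positive integer. Then the following identity holds as a formal power series in $z$, and hence wherever the displayed series converge: $$ \begin{aligned} &a_1(a_2-1)\,F\!\left(\begin{matrix}a_2,\,\mathbf a_{[2]}+1\\ 2,\,\mathbf b_{[1]}+1\end{matrix}\middle|z\right)F\!\left(\begin{matrix}a_1-1,\,\mathbf a_{[1]}\\ 1,\,\mathbf b_{[1]}\end{matrix}\middle|z\right)\\ &-a_2(a_1-1)\,F\!\left(\begin{matrix}a_1,\,\mathbf a_{[1]}+1\\ 2,\,\mathbf b_{[1]}+1\end{matrix}\middle|z\right)F\!\left(\begin{matrix}a_2-1,\,\mathbf a_{[2]}\\ 1,\,\mathbf b_{[1]}\end{matrix}\middle|z\right)\\ &-(a_2-a_1)\,F\!\left(\begin{matrix}\mathbf a\\ 1,\,\mathbf b_{[1]}\end{matrix}\middle|z\right)F\!\left(\begin{matrix}a_1,\,a_2,\,\mathbf a_{[1,2]}+1\\ 1,\,\mathbf b_{[1]}+1\end{matrix}\middle|z\right)\\ &=z\,\frac{(\mathbf a)_1(a_1-a_2)}{(\mathbf b_{[1]})_1}\,F\!\left(\begin{matrix}a_2,\,\mathbf a_{[2]}+1\\ 2,\,\mathbf b_{[1]}+1\end{matrix}\middle|z\right)F\!\left(\begin{matrix}a_1,\,\mathbf a_{[1]}+1\\ 2,\,\mathbf b_{[1]}+1\end{matrix}\middle|z\right),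 \end{aligned} $$ where $(\mathbf a)_1=a_1a_2\cdots a_{r+1}$ and $(\mathbf b_{[1]})_1=b_2\cdots b_r$.
   Context: $F\!\left(\begin{smallmatrix}\mathbf x\\ \mathbf y\end{smallmatrix}\middle|z\right)=\sum_{k\ge0}\frac{\prod_i(x_i)_k}{\prod_i(y_i)_k}\frac{z^k}{k!}$ is the generalized hypergeometric series (here of type ${}_{r+1}F_r$), $(x)_k=\Gamma(x+k)/\Gamma(x)$. $\mathbf a_{[i]}$ is $\mathbf a$ with component $a_i$ removed, $\mathbf a_{[1,2]}$ is $\mathbf a$ with $a_1,a_2$ removed; adding $1$ to a vector is componentwise. Empty products are $1$ (so $(\mathbf b_{[1]})_1=1$ if $r=1$). *)

(* Defs.v *)
From mathcomp Require Import all_boot all_order all_algebra.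
From mathcomp Require Import all_classical all_reals all_analysis.
From mathcomp Require Export complex.

Set Implicit Arguments.
Unset Strict Implicit.
Unset Printing Implicit Defensive.

Import Order.TTheory GRing.Theory Num.Theory.
Import numFieldNormedType.Exports.

Local Open Scope ring_scope.

(* A formal power series is its coefficient sequence.  Sums and scalar
   multiples are the pointwise ones of the lmodType [nat -> K]; its pointwise
   ring product is NOT the product of power series, which is [fps_mul]. *)
Definition fps_mul (K : fieldType) (f g : nat -> K) : nat -> K :=
  fun n => \sum_(i < n.+1) f i * g (n - i)%N.

Definition fps_X (K : fieldType) : nat -> K := fun n => (n == 1)%:R.

Arguments fps_X {K}.

Reserved Notation "f *ps g" (at level 40, left associativity).
Notation "f *ps g" := (fps_mul f g) : ring_scope.

(* (x)_k as the product x (x + 1) ... (x + k - 1): the value of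
   Gamma(x + k) / Gamma(x), and its continuous extension to the poles. *)
Definition poch (K : fieldType) (x : K) (k : nat) : K :=
  \prod_(i < k) (x + i%:R).

(* (x_1, ..., x_m)_k = (x_1)_k ... (x_m)_k *)
Definition pochs (K : fieldType) (xs : seq K) (k : nat) : K :=
  \prod_(x <- xs) poch x k.

(* For lower parameters violating [lower_ok], division by 0 yields 0. *)
Definition hypF (K : fieldType) (xs ys : seq K) : nat -> K :=
  fun k => pochs xs k / pochs ys k / k`!%:R.

Definition lower_ok (K : fieldType) (ys : seq K) : Prop :=
  forall y, y \in ys -> forall n : nat, y != - n%:R.

Definition hypF_terms (K : numFieldType) (xs ys : seq K) (z : K) : nat -> K :=
  fun k => hypF xs ys k * z ^+ k.

(* Convergence of the series at z, possibly only conditional. *)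
Definition hypF_cvg (K : numFieldType) (xs ys : seq K) (z : K) : Prop :=
  cvgn (series (hypF_terms xs ys z)).

(* Only meaningful under [hypF_cvg]. *)
Definition hypF_sum (K : numFieldType) (xs ys : seq K) (z : K) : K :=
  limn (series (hypF_terms xs ys z)).

Definition shift1 (K : fieldType) (xs : seq K) : seq K :=
  [seq x + 1 | x <- xs].

(* [omit I xs] removes the entries of [xs] whose position (counted from 0)
   is in [I]: a_[1] is [omit [:: 0] a], a_[1,2] is [omit [:: 0; 1] a]. *)
Definition omit (K : fieldType) (I : seq nat) (xs : seq K) : seq K :=
  [seq xs`_i | i <- iota 0 (size xs) & i \notin I].

(* Main.v *)
(* With p = a1 - 1, q = a2 - 1 and H = F(a1, a2, a_[1,2] + 1; 1, b_[1] + 1), let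
   I and J have coefficients H_k / (k + 1) and H_k / (k + 1)^2, and let
   g = (a_[1,2])_1 / (b_[1])_1.  All six series are affine in H, I, J:
   a1 and a2 times the ones with lower parameter 2 are H + p I and H + q I, the
   ones with a parameter a1 - 1 resp. a2 - 1 are 1 + p g z (I + q J) and
   1 + q g z (I + p J), and F(a; 1, b_[1]) = 1 + g z (H + (p + q) I + p q J).
   Substituting these makes the formal identity a polynomial one, and needs no
   division by a_i, a_i - 1 or g, any of which may vanish.

   On the boundary of the disc of convergence the series may converge only
   conditionally, and then the Cauchy products need not converge.  By Cesaro's
   theorem they are still Cesaro summable to the product of the sums, and Cesaro
   sums are linear and unique. *)
Require Import Defs.
From mathcomp Require Import all_boot all_order all_algebra.
From mathcomp Require Import all_classical all_reals all_analysis.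
From mathcomp Require Import ring.

Set Implicit Arguments.
Unset Strict Implicit.
Unset Printing Implicit Defensive.

Import Order.TTheory GRing.Theory Num.Theory.
Import numFieldNormedType.Exports.

Local Open Scope ring_scope.

(** * Formal power series and their comparison with truncated polynomials *)

Section FormalPowerSeries.
Variable K : numFieldType.
Implicit Types (f g h : nat -> K) (p q : {poly K}) (n : nat).

(** Coefficient [i] of a product involves only coefficients up to [i] of the factors. Hence
    [fps_mul] inherits ring laws from [{poly K}], where the tactic [ring] applies. *)
Lemma fps_mul_coef f g p q n :
    (forall i, (i <= n)%N -> p`_i = f i) -> (forall i, (i <= n)%N -> q`_i = g i) ->
  forall i, (i <= n)%N -> (p * q)`_i = (f *ps g) i.
Proof.
move=> pf qg i le_in; rewrite coefM; apply: eq_bigr => j _.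
rewrite pf ?qg //; first exact: leq_trans (leq_subr _ _) le_in.
by apply: leq_trans le_in; rewrite -ltnS.
Qed.

Lemma coef_trunc f n i : (i <= n)%N -> (\poly_(j < n.+1) f j)`_i = f i.
Proof. by move=> le_in; rewrite coef_poly ltnS le_in. Qed.

Lemma fps_mulC : commutative (@fps_mul K).
Proof.
move=> f g; apply/funext => n; have le_nn := leqnn n.
by rewrite -!(fps_mul_coef (coef_trunc _ (n:=n)) (coef_trunc _ (n:=n)) le_nn) mulrC.
Qed.

Lemma fps_mulA : associative (@fps_mul K).
Proof.
move=> f g h; apply/funext => n.
have T e := coef_trunc e (n := n); have M e1 e2 := fps_mul_coef (T e1) (T e2).
by rewrite -(fps_mul_coef (T f) (M g h)) // -(fps_mul_coef (M f g) (T h)) // mulrA.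
Qed.

Lemma fps_mulDl f g h : (f + g) *ps h = f *ps h + g *ps h.
Proof.
apply/funext => n; apply: etrans (big_split _ _ _ _ _).
by apply: eq_bigr => i _; exact: mulrDl.
Qed.

Lemma fps_mulZl (c : K) f g : (c *: f) *ps g = c *: (f *ps g).
Proof.
apply/funext => n; apply: etrans (esym (mulr_sumr _ _ _ _)).
by apply: eq_bigr => i _; exact: esym (mulrA _ _ _).
Qed.

Lemma fps_mul_pow (z : K) f g n :
  (f *ps g) n * z ^+ n =
  ((fun k => f k * z ^+ k) *ps (fun k => g k * z ^+ k)) n.
Proof.
rewrite /fps_mul mulr_suml; apply: eq_bigr => i _.
by rewrite mulrACA -exprD subnKC // -ltnS.
Qed.

(** The constant sequence 1 is the geometric series 1/(1 - z). The index is [n.+1] because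
    [series f n] stops before term [n]. *)
Lemma series_fps_mul f n : series f n.+1 = (f *ps (fun=> 1)) n.
Proof. by rewrite /series /= big_mkord; apply: eq_bigr => i _; rewrite mulr1. Qed.

Lemma fps_X_mul f n : (fps_X *ps f) n = if n is n'.+1 then f n' else 0.
Proof.
rewrite /fps_mul /fps_X; case: n => [|n]; first by rewrite big_ord1 mul0r.
rewrite 2!big_ord_recl /= mul0r add0r mul1r subSS subn0 big1 ?addr0 // => i _.
by rewrite mul0r.
Qed.

End FormalPowerSeries.

(** * Pochhammer symbols, lists of parameters and hypergeometric coefficients *)

Section Hypergeometric.
Variable K : numFieldType.
Implicit Types (x y : K) (xs ys : seq K) (k : nat).

Lemma poch_recl x k : poch x k.+1 = x * poch (x + 1) k.
Proof.
rewrite /poch big_ord_recl addr0; congr (_ * _); apply: eq_bigr => i _.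
by rewrite -natr1; ring.
Qed.

Lemma poch_recr x k : poch x k.+1 = poch x k * (x + k%:R).
Proof. by rewrite /poch big_ord_recr. Qed.

Lemma poch1 k : poch 1 k = k`!%:R :> K.
Proof.
elim: k => [|k IH]; first by rewrite /poch big_ord0.
by rewrite poch_recr IH factS natrM -natr1; ring.
Qed.

Lemma poch2 k : poch 2 k = k.+1`!%:R :> K.
Proof. by rewrite -poch1 poch_recl mul1r. Qed.

Lemma pochs_recl xs k : pochs xs k.+1 = pochs xs 1 * pochs (shift1 xs) k.
Proof.
rewrite /pochs big_map -big_split; apply: eq_bigr => x _.
by rewrite !poch_recl /poch big_ord0 mulr1.
Qed.

Lemma pochs_cons x xs k : pochs (x :: xs) k = poch x k * pochs xs k.
Proof. exact: big_cons. Qed.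

Lemma pochs0 xs : pochs xs 0 = 1.
Proof. by rewrite /pochs big1 // => x _; rewrite /poch big_ord0. Qed.

Lemma omit_cat xs ys : omit (iota 0 (size xs)) (xs ++ ys) = ys.
Proof.
rewrite /omit size_cat iotaD add0n filter_cat map_cat.
rewrite (_ : [seq i <- iota 0 _ | _] = [::]); last first.
  by apply/eqP; rewrite -[_ == _]negbK -has_filter; apply/hasPn => i ->.
rewrite (_ : [seq i <- iota _ (size ys) | _] = iota (size xs) (size ys)).
  rewrite -[in iota (size xs)](addn0 (size xs)) iotaDl -map_comp.
  rewrite -[RHS](mkseq_nth 0); apply: eq_map => i /=.
  by rewrite nth_cat ltnNge leq_addr addKn.
apply/all_filterP/allP => i; rewrite !mem_iota add0n.
by case/andP => le_i _; rewrite -leqNgt.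
Qed.

Lemma omit1 x y ys : omit [:: 1%N] [:: x, y & ys] = x :: ys.
Proof.
rewrite -[in RHS](omit_cat [:: x; y] ys) /omit /=.
by congr (_ :: map _ _); apply: eq_in_filter => -[|[|i]] //; rewrite mem_iota.
Qed.

Lemma hypF0 xs ys : hypF xs ys 0 = 1.
Proof. by rewrite /hypF !pochs0 fact0 !divr1. Qed.

Lemma hypF_swap x y xs ys : hypF [:: x, y & xs] ys = hypF [:: y, x & xs] ys.
Proof. by apply/funext => k; rewrite /hypF !pochs_cons mulrCA. Qed.

End Hypergeometric.

(** * Contiguous relations and the formal identity; [c] plays the role of a_[1,2] *)

Section ContiguousRelations.
Variables (K : numFieldType) (c b : seq K).
Implicit Types (x y : K) (k : nat).

Let H x y := hypF [:: x, y & shift1 c] (1 :: shift1 b).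
Let g := pochs c 1 / pochs b 1.

(** From x (x + 1)_k = (x)_k (x + k) and (2)_k = (k + 1)!. Since x + k = (x - 1) + (k + 1), this is
    the relation giving H + p I. *)
Lemma hypF_lower2 x y k :
  x * hypF [:: y, x + 1 & shift1 c] (2 :: shift1 b) k =
  H x y k * (x + k%:R) / k.+1%:R.
Proof.
rewrite /H /hypF !pochs_cons poch1 poch2 factS natrM !invfM.
have := poch_recr x k; rewrite poch_recl => E.
by ring: E.
Qed.

(** Splitting off the first factor of the symbols in [c] and [b] produces [g]; splitting off the
    last factor for [x] and [y] keeps them unshifted in [H]. *)
Lemma hypF_shift x y k :
  hypF [:: x, y & c] (1 :: b) k.+1 =
  g * H x y k * ((x + k%:R) * (y + k%:R)) / k.+1%:R ^+ 2.
Proof.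
rewrite /g /H /hypF !pochs_cons !poch1 !(pochs_recl _ k) !poch_recr factS natrM !invfM.
by ring.
Qed.

(** Here (x - 1)_(k+1) = (x - 1) (x)_k, so only [y] leaves a factor depending on [k], and (y + k) /
    (k + 1)^2 yields I + q J. *)
Lemma hypF_shift_pred x y k :
  hypF [:: x - 1, y & c] (1 :: b) k.+1 =
  (x - 1) * g * H x y k * (y + k%:R) / k.+1%:R ^+ 2.
Proof.
rewrite /g /H /hypF !pochs_cons !poch1 !(pochs_recl _ k) poch_recl poch_recr.
rewrite subrK factS natrM !invfM.
by ring.
Qed.

Lemma hypF_formal_identity x y :
  (x * (y - 1)) *: (hypF [:: y, x + 1 & shift1 c] (2 :: shift1 b)
                    *ps hypF [:: x - 1, y & c] (1 :: b))
  - (y * (x - 1)) *: (hypF [:: x, y + 1 & shift1 c] (2 :: shift1 b)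
                      *ps hypF [:: y - 1, x & c] (1 :: b))
  - (y - x) *: (hypF [:: x, y & c] (1 :: b) *ps H x y)
  = (pochs [:: x, y & c] 1 * (x - y) / pochs b 1) *:
    (fps_X *ps (hypF [:: y, x + 1 & shift1 c] (2 :: shift1 b)
                *ps hypF [:: x, y + 1 & shift1 c] (2 :: shift1 b))).
Proof.
apply/funext => n; have T (e : nat -> K) := coef_trunc e (n := n).
set F1 := hypF [:: y, _ & _] _; set F2 := hypF [:: x, y + 1 & _] _.
set G1 := hypF [:: x - 1, _ & _] _; set G2 := hypF [:: y - 1, _ & _] _.
set F := hypF [:: x, y & c] _.
(* Truncations of H, I, J: coefficient [n] of the identity sees nothing beyond degree [n]. *)
pose h := \poly_(k < n.+1) H x y k.
pose i := \poly_(k < n.+1) (H x y k / k.+1%:R).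
pose j := \poly_(k < n.+1) (H x y k / k.+1%:R ^+ 2).
pose f1 := \poly_(k < n.+1) F1 k.
pose f2 := \poly_(k < n.+1) F2 k.
pose G := g%:P; pose p := (x - 1)%:P; pose q := (y - 1)%:P.
(* These three are the affine expressions themselves; they need to match their series only up to
   degree [n], whereas [E1] and [E2] are exact polynomial equalities. *)
pose g1 : {poly K} := 1 + 'X * ((p * G) * (i + q * j)).
pose g2 : {poly K} := 1 + 'X * ((q * G) * (i + p * j)).
pose f : {poly K} := 1 + 'X * (G * (h + (p + q) * i + p * q * j)).
have E1 : x%:P * f1 = h + p * i.
  apply/polyP => k; rewrite !(coefD, coefCM) !coef_poly.
  case: ifP => _; last by rewrite !mulr0 addr0.
  by rewrite hypF_lower2 -natr1; field; rewrite natr1.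
have E2 : y%:P * f2 = h + q * i.
  apply/polyP => k; rewrite !(coefD, coefCM) !coef_poly.
  case: ifP => _; last by rewrite !mulr0 addr0.
  by rewrite hypF_lower2 /H hypF_swap -natr1; field; rewrite natr1.
have EG1 k : (k <= n)%N -> g1`_k = G1 k.
  case: k => [|k] kn; rewrite coefD coefXM coef1 /=.
    by rewrite addr0; exact/esym/hypF0.
  rewrite add0r -mulrA !(coefCM, coefD) !coef_trunc 1?ltnW // [RHS]hypF_shift_pred -natr1.
  by field; rewrite natr1.
have EG2 k : (k <= n)%N -> g2`_k = G2 k.
  case: k => [|k] kn; rewrite coefD coefXM coef1 /=.
    by rewrite addr0; exact/esym/hypF0.
  rewrite add0r -mulrA !(coefCM, coefD) !coef_trunc 1?ltnW // [RHS]hypF_shift_pred.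
  rewrite /H hypF_swap -natr1.
  by field; rewrite natr1.
have EF k : (k <= n)%N -> f`_k = F k.
  case: k => [|k] kn; rewrite coefD coefXM coef1 /=.
    by rewrite addr0; exact/esym/hypF0.
  rewrite add0r -mulrA -polyCD !(coefCM, coefD) !coef_trunc 1?ltnW // [RHS]hypF_shift -natr1.
  by field; rewrite natr1.
have EX k : (k <= n)%N -> ('X * (f1 * f2))`_k = (fps_X *ps (F1 *ps F2)) k.
  move=> kn; rewrite coefXM fps_X_mul; case: k kn => //= k kn.
  by rewrite (fps_mul_coef (T _) (T _)) // ltnW.
have Ec : pochs [:: x, y & c] 1 * (x - y) / pochs b 1 = x * y * (x - y) * g.
  by rewrite /g !pochs_cons /poch !big_ord1 !addr0; ring.
transitivity ((x * (y - 1)) * (F1 *ps G1) n - (y * (x - 1)) * (F2 *ps G2) n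
     - (y - x) * (F *ps H x y) n) => //.
transitivity ((x * y * (x - y) * g) * (fps_X *ps (F1 *ps F2)) n); last by rewrite Ec.
rewrite -(fps_mul_coef (T _) EG1) // -(fps_mul_coef (T _) EG2) //.
rewrite -(fps_mul_coef EF (T _)) // -EX // -!coefCM -!coefB.
congr ((polyseq _)`_n); rewrite (polyCM _ g) -/G !(polyCM, polyCB) -/h -/f1 -/f2 ?polyC1.
(* Grouping [x] with [f1] and [y] with [f2] makes [E1] and [E2] applicable; after substitution the
   constant parts and all terms in [j] cancel. *)
transitivity (q * (x%:P * f1) * g1 - p * (y%:P * f2) * g2 - (q - p) * (f * h)).
  by rewrite /p /q !polyCB ?polyC1; ring.
transitivity ((p - q) * G * 'X * ((x%:P * f1) * (y%:P * f2))); last first.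
  by rewrite /p /q !polyCB ?polyC1; ring.
by rewrite E1 E2 /g1 /g2 /f; ring.
Qed.

End ContiguousRelations.

(** * Cesaro summability of Cauchy products *)

Section Cesaro.
Local Open Scope classical_set_scope.
Variable K : numFieldType.
Hypothesis archiK : forall x : K, 0 <= x -> exists n : nat, x < n%:R.
Implicit Types (f g u v : nat -> K) (A B z : K).

Lemma cvg_conv_mean0 u v M : 0 < M -> (forall n, `|v n| <= M) -> u @ \oo --> (0 : K) ->
  (fun n => (u *ps v) n / n.+1%:R) @ \oo --> (0 : K).
Proof.
move=> M0 vM u0; apply/cvgr0Pnorm_lt => e e0.
(* Beyond [N] the terms contribute at most [e / 2] to the mean. The first [N] contribute at most
   [C * M] to the sum, which [N'] makes less than [e / 2] after division by [n.+1]. *)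
have [|N _ uN] := (cvgr0Pnorm_lt u).1 u0 (e / 2 / M); first by rewrite !divr_gt0.
pose C := \sum_(k < N) `|u k|.
have C0 : 0 <= C by apply: sumr_ge0.
have [|N' CN'] := @archiK (C * M / (e / 2)).
  by rewrite divr_ge0 ?mulr_ge0 ?divr_ge0 // ltW.
exists (N + N')%N => // n /= NN'n.
have n0 : 0 < n.+1%:R :> K by rewrite ltr0n.
rewrite normrM normfV (gtr0_norm n0) ltr_pdivrMr //.
have bound : `|(u *ps v) n| <= \sum_(i < n.+1) `|u i| * M.
  apply: le_trans (ler_norm_sum _ _ _) _.
  by apply: ler_sum => i _; rewrite normrM ler_wpM2l.
apply: le_lt_trans bound _; rewrite -mulr_suml.
have usum : \sum_(i < n.+1) `|u i| <= C + n.+1%:R * (e / 2 / M).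
  have -> : n.+1 = (N + (n.+1 - N))%N
    by rewrite subnKC // ltnW // ltnS (leq_trans (leq_addr _ _) NN'n).
  rewrite big_split_ord /= lerD2l.
  have : \sum_(i < n.+1 - N) `|u (N + i)%N| <= \sum_(i < n.+1 - N) (e / 2 / M).
    by apply: ler_sum => i _; apply/ltW/uN => /=; exact: leq_addr.
  move=> /le_trans; apply; rewrite sumr_const card_ord -[leLHS]mulr_natl.
  apply: ler_wpM2r; last by rewrite ler_nat leq_addl.
  by rewrite !divr_ge0 ?ltW.
apply: le_lt_trans (ler_wpM2r (ltW M0) usum) _.
have -> : (C + n.+1%:R * (e / 2 / M)) * M = C * M + e / 2 * n.+1%:R.
  by field; rewrite gt_eqF.
rewrite [in ltRHS](splitr e) [ltRHS]mulrDl ltrD2r -ltr_pdivrMl ?divr_gt0 // mulrC.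
apply: lt_le_trans CN' _; rewrite ler_nat.
by rewrite leqW // (leq_trans (leq_addl _ _) NN'n).
Qed.

(** Centring both sequences splits the mean into two means with a null factor and a bounded one,
    plus the constant [A * B]. *)
Lemma cvg_conv_mean u v A B : u @ \oo --> A -> v @ \oo --> B ->
  (fun n => (u *ps v) n / n.+1%:R) @ \oo --> A * B.
Proof.
move=> uA vB.
have u0 : (fun n => u n - A) @ \oo --> (0 : K) by apply/subr_cvg0.
have v0 : (fun n => v n - B) @ \oo --> (0 : K) by apply/subr_cvg0.
have [M M0 vM] : exists2 M : K, 0 < M & forall n, `|v n| <= M.
  have /cvg_seq_bounded/pinfty_ex_gt0[M M0 /= vM] : cvgn v by apply/cvg_ex; exists B.
  by exists M => // n; apply: vM.
(* A strictly positive bound for the constant sequence [A], which may be zero. *)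
have B1 : 0 < `|A| + 1 by rewrite ltr_wpDl.
rewrite (_ : (fun n => _) = fun n => ((fun k => u k - A) *ps v) n / n.+1%:R
    + ((fun k => v k - B) *ps (fun=> A)) n / n.+1%:R + A * B).
  have E : A * B = 0 + 0 + A * B by rewrite !add0r.
  rewrite [in X in _ --> X]E.
  have A1 (_ : nat) : `|A| <= `|A| + 1 by rewrite lerDl.
  exact: cvgD (cvgD (cvg_conv_mean0 M0 vM u0) (cvg_conv_mean0 B1 A1 v0)) (cvg_cst _).
apply/funext => n /=; rewrite (fps_mulC _ (fun=> A)).
have nz : n.+1%:R != 0 :> K by rewrite pnatr_eq0.
apply: (mulIf nz); rewrite !mulrDl !divfK // mulr_natr -[X in _ *+ X](card_ord n.+1).
rewrite -sumr_const -!big_split.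
by apply: eq_bigr => i _ /=; ring.
Qed.

(* [f *ps (fun=> 1)] is the sequence of partial sums of [f]. *)
Definition cesaro_mean f n : K := ((f *ps (fun=> 1)) *ps (fun=> 1)) n / n.+1%:R.

(** Summing [f *ps g] twice multiplies it by two copies of the constant sequence 1. Giving one copy
    to each factor turns the Cesaro mean into the mean of the convolved partial sums. *)
Lemma cvg_cesaro_mean_fps_mul f g A B :
  series f @ \oo --> A -> series g @ \oo --> B ->
  cesaro_mean (f *ps g) @ \oo --> A * B.
Proof.
rewrite -(cvg_shiftS (series f)) -(cvg_shiftS (series g)) => fA gB.
rewrite [cesaro_mean _](_ : _ = fun n =>
  ((fun k => series f k.+1) *ps (fun k => series g k.+1)) n / n.+1%:R).
  exact: cvg_conv_mean.
apply/funext => n; rewrite /cesaro_mean.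
rewrite (_ : (fun k => series f k.+1) = f *ps (fun=> 1)); last exact/funext/series_fps_mul.
rewrite (_ : (fun k => series g k.+1) = g *ps (fun=> 1)); last exact/funext/series_fps_mul.
by rewrite -!fps_mulA (fps_mulC (fun=> 1) (g *ps _)) -!fps_mulA.
Qed.

Lemma cesaro_meanD f g : cesaro_mean (f + g) = cesaro_mean f + cesaro_mean g.
Proof. by apply/funext => n; rewrite /cesaro_mean !fps_mulDl; exact: mulrDl. Qed.

Lemma cesaro_meanZ (a : K) f : cesaro_mean (a *: f) = a *: cesaro_mean f.
Proof. by apply/funext => n; rewrite /cesaro_mean !fps_mulZl; exact: esym (mulrA _ _ _). Qed.

Lemma cvg_series_fps_X_mul z f A : series (fun k => f k * z ^+ k) @ \oo --> A ->
  series (fun k => (fps_X *ps f) k * z ^+ k) @ \oo --> z * A.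
Proof.
move=> fA; rewrite -cvg_shiftS.
rewrite (_ : (fun n => _) = (fun n => z * series (fun k => f k * z ^+ k) n)).
  exact: cvgZl_tmp.
apply/funext => n; rewrite /series /= big_nat_recl // fps_X_mul mul0r add0r mulr_sumr.
by apply: eq_bigr => k _; rewrite fps_X_mul exprS mulrCA.
Qed.

End Cesaro.

(** In the partial order of [R[i]], [0 <= x] forces [x] to be real. *)
Lemma complex_archimedean (R : realType) (x : R[i]) :
  0 <= x -> exists n : nat, x < n%:R.
Proof.
case: x => x y; rewrite lecE /= => /andP[/eqP-> x0].
exists (Num.truncn x).+1; rewrite -(rmorph_nat (real_complex R)) ltcE /= eqxx /=.
exact: truncnS_gt.
Qed.

(** * From the formal identity to the sums at a point *)

Section Sums.
Local Open Scope classical_set_scope.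
Variable K : numFieldType.
Hypothesis archiK : forall x : K, 0 <= x -> exists n : nat, x < n%:R.
Variable z : K.
Implicit Types (f g : nat -> K) (a A B : K).

Definition fps_sums_to f A := series (fun k => f k * z ^+ k) @ \oo --> A.

Definition fps_cesaro_to f A := cesaro_mean (fun k => f k * z ^+ k) @ \oo --> A.

Lemma fps_cesaro_to_mul f g A B :
  fps_sums_to f A -> fps_sums_to g B -> fps_cesaro_to (f *ps g) (A * B).
Proof.
move=> fA gB; rewrite /fps_cesaro_to (_ : (fun k => _) =
  (fun k => f k * z ^+ k) *ps (fun k => g k * z ^+ k)).
  exact: cvg_cesaro_mean_fps_mul.
by apply/funext => k; exact: fps_mul_pow.
Qed.

Lemma fps_cesaro_toZ a f A : fps_cesaro_to f A -> fps_cesaro_to (a *: f) (a * A).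
Proof.
move=> fA; rewrite /fps_cesaro_to (_ : (fun k => _) = a *: (fun k => f k * z ^+ k)).
  by rewrite cesaro_meanZ; exact: cvgZl_tmp.
by apply/funext => k; exact: esym (mulrA _ _ _).
Qed.

Lemma fps_cesaro_toB f g A B :
  fps_cesaro_to f A -> fps_cesaro_to g B -> fps_cesaro_to (f - g) (A - B).
Proof.
move=> fA gB; rewrite -(mulN1r B) -(scaleN1r g).
have {}gB := fps_cesaro_toZ (a := -1) gB.
rewrite /fps_cesaro_to (_ : (fun k => _) =
  (fun k => f k * z ^+ k) + (fun k => (-1 *: g) k * z ^+ k)).
  by rewrite cesaro_meanD; exact: (cvgD fA gB).
by apply/funext => k; apply: mulrDl.
Qed.

Lemma fps_cesaro_to_unique f A B : fps_cesaro_to f A -> fps_cesaro_to f B -> A = B.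
Proof. by apply: cvg_unique; exact: norm_hausdorff. Qed.

Lemma fps_sums_toX f A : fps_sums_to f A -> fps_sums_to (fps_X *ps f) (z * A).
Proof. exact: cvg_series_fps_X_mul. Qed.

(** By conversion: [cvgn] means convergence to [limn]. *)
Lemma hypF_sums_to xs ys : hypF_cvg xs ys z -> fps_sums_to (hypF xs ys) (hypF_sum xs ys z).
Proof. by []. Qed.

Lemma hypF_sum_identity (c b : seq K) x y :
  hypF_cvg [:: y, x + 1 & shift1 c] (2 :: shift1 b) z ->
  hypF_cvg [:: x - 1, y & c] (1 :: b) z ->
  hypF_cvg [:: x, y + 1 & shift1 c] (2 :: shift1 b) z ->
  hypF_cvg [:: y - 1, x & c] (1 :: b) z ->
  hypF_cvg [:: x, y & c] (1 :: b) z ->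
  hypF_cvg [:: x, y & shift1 c] (1 :: shift1 b) z ->
    x * (y - 1) * hypF_sum [:: y, x + 1 & shift1 c] (2 :: shift1 b) z
                * hypF_sum [:: x - 1, y & c] (1 :: b) z
  - y * (x - 1) * hypF_sum [:: x, y + 1 & shift1 c] (2 :: shift1 b) z
                * hypF_sum [:: y - 1, x & c] (1 :: b) z
  - (y - x) * hypF_sum [:: x, y & c] (1 :: b) z
            * hypF_sum [:: x, y & shift1 c] (1 :: shift1 b) z
  = z * (pochs [:: x, y & c] 1 * (x - y) / pochs b 1)
      * hypF_sum [:: y, x + 1 & shift1 c] (2 :: shift1 b) z
      * hypF_sum [:: x, y + 1 & shift1 c] (2 :: shift1 b) z.
Proof.
move=> /hypF_sums_to F1 /hypF_sums_to G1 /hypF_sums_to F2 /hypF_sums_to G2.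
move=> /hypF_sums_to F /hypF_sums_to H.
have L := fps_cesaro_toB
  (fps_cesaro_toB (fps_cesaro_toZ (a := x * (y - 1)) (fps_cesaro_to_mul F1 G1))
                  (fps_cesaro_toZ (a := y * (x - 1)) (fps_cesaro_to_mul F2 G2)))
  (fps_cesaro_toZ (a := y - x) (fps_cesaro_to_mul F H)).
(* Reassociating attaches [fps_X] to the first series, which still converges in the ordinary sense;
   the right side is then again a product of two convergent series. *)
rewrite hypF_formal_identity fps_mulA in L.
have := fps_cesaro_to_unique L (fps_cesaro_toZ (fps_cesaro_to_mul (fps_sums_toX F1) F2)).
by move=> EL; apply: etrans (etrans EL _); ring.
Qed.

End Sums.

Theorem theorem4p3 (R : realType) (r : nat) (hr : (1 <= r)%N)
    (a : r.+1.-tuple R[i]) (b : r.-1.-tuple R[i]) :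
  let a1 := a`_0 in
  let a2 := a`_1 in
  let a_1 := omit [:: 0%N] a in
  let a_2 := omit [:: 1%N] a in
  let a_12 := omit [:: 0%N; 1%N] a in
  let c := pochs a 1 * (a1 - a2) / pochs b 1 in
  lower_ok (1 :: b) ->
  lower_ok (1 :: shift1 b) ->
  lower_ok (2 :: shift1 b) ->
  (   (a1 * (a2 - 1)) *: (hypF (a2 :: shift1 a_2) (2 :: shift1 b)
                          *ps hypF ((a1 - 1) :: a_1) (1 :: b))
    - (a2 * (a1 - 1)) *: (hypF (a1 :: shift1 a_1) (2 :: shift1 b)
                          *ps hypF ((a2 - 1) :: a_2) (1 :: b))
    - (a2 - a1) *: (hypF a (1 :: b)
                    *ps hypF (a1 :: a2 :: shift1 a_12) (1 :: shift1 b))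
    = c *: (fps_X *ps (hypF (a2 :: shift1 a_2) (2 :: shift1 b)
                       *ps hypF (a1 :: shift1 a_1) (2 :: shift1 b))))
  /\
  (forall z : R[i],
    hypF_cvg (a2 :: shift1 a_2) (2 :: shift1 b) z ->
    hypF_cvg ((a1 - 1) :: a_1) (1 :: b) z ->
    hypF_cvg (a1 :: shift1 a_1) (2 :: shift1 b) z ->
    hypF_cvg ((a2 - 1) :: a_2) (1 :: b) z ->
    hypF_cvg a (1 :: b) z ->
    hypF_cvg (a1 :: a2 :: shift1 a_12) (1 :: shift1 b) z ->
      a1 * (a2 - 1) * hypF_sum (a2 :: shift1 a_2) (2 :: shift1 b) z
                    * hypF_sum ((a1 - 1) :: a_1) (1 :: b) z
    - a2 * (a1 - 1) * hypF_sum (a1 :: shift1 a_1) (2 :: shift1 b) z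
                    * hypF_sum ((a2 - 1) :: a_2) (1 :: b) z
    - (a2 - a1) * hypF_sum a (1 :: b) z
                * hypF_sum (a1 :: a2 :: shift1 a_12) (1 :: shift1 b) z
    = z * c * hypF_sum (a2 :: shift1 a_2) (2 :: shift1 b) z
            * hypF_sum (a1 :: shift1 a_1) (2 :: shift1 b) z).
Proof.
move=> a1 a2 a_1 a_2 a_12 c _ _ _.
(* As [r] is at least 1, [a] has two leading entries, and [s] is a_[1,2]. *)
have [s Ea] : exists s, tval a = [:: a1, a2 & s].
  rewrite /a1 /a2; case: (tval a) (size_tuple a) => [|x [|y s]] /= => [//||_].
    by move=> [r0]; rewrite -r0 in hr.
  by exists s.
have -> : a_1 = a2 :: s by rewrite /a_1 Ea (omit_cat [:: a1]).
have -> : a_2 = a1 :: s by rewrite /a_2 Ea omit1.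
have -> : a_12 = s by rewrite /a_12 Ea (omit_cat [:: a1; a2]).
rewrite /c Ea /=.
split=> [|z]; first exact: hypF_formal_identity.
exact: hypF_sum_identity (@complex_archimedean R) _ _ _ _ _.
Qed.
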